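(* The sequence of objective values $\{\mathbb E[z^k(\tilde\xi)s^k(\tilde\xi)]\}_{k\in\mathbb Z_+}$ generated by the Alternating Minimization (AM) method is monotonically nonincreasing, bounded from below, and hence converges.
   Context: Setting. $\tilde\xi$ is a random vector on a probability space $(\Omega,\mathcal F,\mathbb P)$ with support $\Xi\subseteq\mathbb R^m$; $\varepsilon\in(0,1)$; $c\in\mathbb R^n$; $t$ is a given real number; $z(\cdot),s(\cdot):\Xi\to\mathbb R$ are functional variables; constraints on random quantities hold almost surely. Standing assumptions: $g(x,\xi)=\max_{i\in[I]}g_i(x,\xi)$ with each $g_i:\mathbb R^n\times\Xi\to\mathbb R$ convex and lower semicontinuous in $x$ for almost every $\xi\in\Xi$; $\mathcal X\subseteq\mathbb R^n$ is nonempty, closed, convex, and contained in a closed pointed convex cone $\mathcal C$; the chance constrained program $\min_{x\in\mathcal X}\{c^\top x:\mathbb P\{g(x,\tilde\xi)\le0\}\ge1-\varepsilon\}$ is feasible and $c\in\mathrm{int}(\mathcal C^* )\cup\{0\}$, where $\mathcal C^*$ is the dual cone of $\mathcal C$. The AM method is applied to the problem $$\min_{x\in\mathcal X,\,z(\cdot)\in[0,1],\,s(\cdot)\ge0}\{\mathbb E[z(\tilde\xi)s(\tilde\xi)]:\ g(x,\tilde\xi)\le s(\tilde\xi),\ \mathbb E[z(\tilde\xi)]\ge1-\varepsilon,\ c^\top x\le t\}.$$ It starts at $k=0$ from a given initial solution $z^0(\cdot)$ of $z(\cdot)$, with $(x^0,s^0(\cdot))$ denoting the initial pair. At iteration $k+1$,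 using $(x^k,s^k(\cdot))$ from the previous iteration, it computes $$z^{k+1}(\cdot)\in\operatorname*{argmin}_{z(\cdot)}\{\mathbb E[z(\tilde\xi)s^k(\tilde\xi)]:\ z(\tilde\xi)\in[0,1],\ \mathbb E[z(\tilde\xi)]\ge1-\varepsilon\},$$ and then $$(x^{k+1},s^{k+1}(\cdot))\in\operatorname*{argmin}_{x\in\mathcal X,\,s(\cdot)}\{\mathbb E[z^{k+1}(\tilde\xi)s(\tilde\xi)]:\ c^\top x\le t,\ g(x,\tilde\xi)\le s(\tilde\xi),\ s(\tilde\xi)\ge0\}.$$ In practice the iterations are stopped once $|\mathbb E[z^{k+1}(\tilde\xi)s^{k+1}(\tilde\xi)]-\mathbb E[z^{k}(\tilde\xi)s^{k}(\tilde\xi)]|$ falls below a tolerance $\delta_2$; the statement concerns the sequence of objective values of the iterates. *)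

(* Defs.v *)
From HB Require Import structures.
From mathcomp Require Import all_boot all_order all_algebra.
From mathcomp Require Import all_classical all_reals all_analysis.

Set Implicit Arguments.
Unset Strict Implicit.
Unset Printing Implicit Defensive.

Import Order.TTheory GRing.Theory Num.Theory numFieldNormedType.Exports.

Local Open Scope classical_set_scope.
Local Open Scope ring_scope.

(* R^m with its Borel sigma-algebra. It is convertible to 'cV[R]_m.           *)
Notation borel_cV R m := (g_sigma_algebraType (@open 'cV[R]_m)).

Section vectors_and_cones.
Context {R : realType} {n : nat}.
Implicit Types (C : set 'cV[R]_n) (x y : 'cV[R]_n).

Definition dotv x y : R := (x^T *m y) 0 0.

(* "Pointed" means that C contains no line: C and -C only share the origin.   *)
Definition closed_pointed_convex_cone C : Prop :=
  [/\ closed C, convex_set C, C 0,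
      forall (a : R) x, 0 <= a -> C x -> C (a *: x)
    & forall x, C x -> C (- x) -> x = 0].

Definition dual_cone C : set 'cV[R]_n :=
  [set y | forall x, C x -> 0 <= dotv y x].

End vectors_and_cones.

Definition argmin_on {R : realType} {T : Type} (D : set T) (f : T -> \bar R) :
    set T :=
  [set a | D a /\ forall b, D b -> (f a <= f b)%E].

(* g = max_i g_i over a nonempty family; the neutral element is itself a      *)
(* member of the family, so it does not affect the maximum.                   *)
Definition gmax {R : realType} {n m p : nat}
    (g : 'I_p.+1 -> 'cV[R]_n -> 'cV[R]_m -> R) (x : 'cV[R]_n) (u : 'cV[R]_m) : R :=
  \big[Num.max/g ord0 x u]_(i < p.+1) g i x u.

(* Functions on the support Xi of xi (the g_i(x, .), z and s) are represented *)
(* by functions on R^m. As xi lies in Xi almost surely, their values outside  *)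
(* Xi are irrelevant, and every Borel function on the closed set Xi extends   *)
(* to a Borel function on R^m.                                                *)
Section alternating_minimization.
Context {d : measure_display} {Omega : measurableType d} {R : realType}.
Context (P : probability Omega R) {n m p : nat}.
Context (xi : {RV P >-> borel_cV R m}).
Context (g : 'I_p.+1 -> 'cV[R]_n -> 'cV[R]_m -> R).
Context (X : set 'cV[R]_n) (c : 'cV[R]_n) (eps t : R).
Implicit Types (x : 'cV[R]_n) (z s : {mfun borel_cV R m >-> R}).

(* The smallest closed set that contains xi almost surely.                    *)
Definition is_support (Xi : set 'cV[R]_m) : Prop :=
  [/\ closed Xi, P (xi @^-1` Xi) = 1%E
    & forall A : set 'cV[R]_m, closed A -> P (xi @^-1` A) = 1%E -> Xi `<=` A].

(* The value of P is meaningful on measurable sets only, hence the first      *)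
(* component.                                                                 *)
Definition chance_constraint x : Prop :=
  let event := [set w | gmax g x (xi w) <= 0] in
  measurable event /\ ((1 - eps)%:E <= P event)%E.

Definition z_feasible z : Prop :=
  {ae P, forall w, 0 <= z (xi w) <= 1} /\
  ((1 - eps)%:E <= 'E_P[z \o xi])%E.

Definition xs_feasible x s : Prop :=
  [/\ X x, dotv c x <= t, {ae P, forall w, gmax g x (xi w) <= s (xi w)}
    & {ae P, forall w, 0 <= s (xi w)}].

(* Extended real: on feasible points the integrand is nonnegative almost      *)
(* surely, but its expectation may be +oo.                                    *)
Definition objective z s : \bar R := 'E_P[fun w => z (xi w) * s (xi w)].

(* (z k, x k, s k) is the k-th iterate; the initial triple is any feasible    *)
(* point of the joint problem. No stopping rule is imposed.                   *)
Record AM_iterates (z : nat -> {mfun borel_cV R m >-> R})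
    (x : nat -> 'cV[R]_n) (s : nat -> {mfun borel_cV R m >-> R}) : Prop :=
  AMIterates {
    AM_init_z : z_feasible (z 0%N);
    AM_init_xs : xs_feasible (x 0%N) (s 0%N);
    AM_step_z : forall k,
      argmin_on z_feasible (fun z' => objective z' (s k)) (z k.+1);
    AM_step_xs : forall k,
      argmin_on [set xs | xs_feasible xs.1 xs.2]
        (fun xs => objective (z k.+1) xs.2) (x k.+1, s k.+1) }.

End alternating_minimization.

(* Main.v *)
Require Import Defs.
From HB Require Import structures.
From mathcomp Require Import all_boot all_order all_algebra.
From mathcomp Require Import all_classical all_reals all_analysis.
From mathcomp Require Import measurable_realfun.

Set Implicit Arguments.
Unset Strict Implicit.
Unset Printing Implicit Defensive.

Import Order.TTheory GRing.Theory Num.Theory numFieldNormedType.Exports.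

Local Open Scope classical_set_scope.
Local Open Scope ring_scope.

(** Each half-step of AM minimizes the objective in one block while the other is frozen, and the
    previous value of that block is still a feasible competitor, so neither half-step can increase
    the objective ([AM_objective_nonincreasing]). Almost surely both factors of the integrand are
    nonnegative, so 0 is a lower bound ([objective_ge0]). A monotone sequence in the extended reals
    converges to its infimum, which is a real number as soon as one value is finite. *)

Section objective_theory.
Context {d : measure_display} {Omega : measurableType d} {R : realType}.
Context (P : probability Omega R) {n m p : nat}.
Context (xi : {RV P >-> borel_cV R m}).
Context (g : 'I_p.+1 -> 'cV[R]_n -> 'cV[R]_m -> R).
Context (X : set 'cV[R]_n) (c : 'cV[R]_n) (eps t : R).

Lemma objective_ge0 (z s : {mfun borel_cV R m >-> R}) x :
  z_feasible xi eps z -> xs_feasible xi g X c t x s ->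
  (0 <= objective xi z s)%E.
Proof.
move=> [z01 _] [_ _ _ s_ge0]; rewrite /objective unlock.
have mzs : measurable_fun setT (fun w => z (xi w) * s (xi w)).
  by apply: measurable_funM; apply: measurableT_comp.
(* The sign of the integrand is known only almost surely, so it is traded for its absolute value,
   which is nonnegative everywhere and has the same integral. *)
rewrite (@ae_eq_integral _ _ _ _ _
  (fun w => `|z (xi w) * s (xi w)|%:E)) //.
- by apply: integral_ge0 => w _; rewrite lee_fin.
- exact/measurable_EFinP.
- by apply/measurable_EFinP; exact: measurableT_comp.
- apply: filterS2 z01 s_ge0 => w /andP[z_ge0 _] s_ge0 _ /=.
  by rewrite ger0_norm ?mulr_ge0.
Qed.

Lemma AM_z_feasible z x s k :
  AM_iterates xi g X c eps t z x s -> z_feasible xi eps (z k).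
Proof. by case=> z0 _ Hz _; case: k => [//|k]; case: (Hz k). Qed.

Lemma AM_xs_feasible z x s k :
  AM_iterates xi g X c eps t z x s -> xs_feasible xi g X c t (x k) (s k).
Proof. by case=> _ xs0 _ Hxs; case: k => [//|k]; case: (Hxs k). Qed.

(** The chain is E[z^{k+1} s^{k+1}] <= E[z^{k+1} s^k] <= E[z^k s^k], one inequality per argmin. *)
Lemma AM_objective_nonincreasing z x s :
  AM_iterates xi g X c eps t z x s ->
  nonincreasing_seq (fun k => objective xi (z k) (s k)).
Proof.
move=> AM; apply/nonincreasing_seqP => k.
have [_ z_min] := AM_step_z AM k; have [_ xs_min] := AM_step_xs AM k.
(* [z k] competes in the z-step, then [(x k, s k)] in the (x, s)-step. *)
apply: le_trans (z_min _ (AM_z_feasible k AM)).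
exact: (xs_min (x k, s k) (AM_xs_feasible k AM)).
Qed.

End objective_theory.

Theorem proposition6 (R : realType) (d : measure_display)
    (Omega : measurableType d) (P : probability Omega R) (n m p : nat)
    (xi : {RV P >-> borel_cV R m}) (Xi : set 'cV[R]_m)
    (g : 'I_p.+1 -> 'cV[R]_n -> 'cV[R]_m -> R)
    (X C : set 'cV[R]_n) (c : 'cV[R]_n) (eps t : R)
    (z : nat -> {mfun borel_cV R m >-> R}) (x : nat -> 'cV[R]_n)
    (s : nat -> {mfun borel_cV R m >-> R})
    (supp_xi : is_support xi Xi)
    (eps01 : 0 < eps < 1)
    (g_convex : forall i, {ae P, forall w,
       convex_function setT (fun y : 'cV[R]_n => g i y (xi w))})
    (g_lsc : forall i, {ae P, forall w,
       lower_semicontinuous (fun y : 'cV[R]_n => (g i y (xi w))%:E)})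
    (X_neq0 : X !=set0) (X_closed : closed X) (X_convex : convex_set X)
    (C_cone : closed_pointed_convex_cone C) (X_sub_C : X `<=` C)
    (ccp_feasible : exists2 y, X y & chance_constraint xi g eps y)
    (c_dual : ((dual_cone C)° `|` [set 0]) c)
    (AM : AM_iterates xi g X c eps t z x s) :
  let v : nat -> \bar R := fun k => objective xi (z k) (s k) in
  [/\ nonincreasing_seq v,
      exists b : R, forall k, (b%:E <= v k)%E,
      cvgn v
    & forall k, (v k < +oo)%E -> exists l : R, v @ \oo --> l%:E].
Proof.
move=> v.
have v_noninc : nonincreasing_seq v := AM_objective_nonincreasing AM.
have v_ge0 k : (0 <= v k)%E.
  exact: objective_ge0 (AM_z_feasible k AM) (AM_xs_feasible k AM).
split => //; first by exists 0.
  (* Convergence here is in [\bar R]: the limit may still be [+oo]. *)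
  exact: ereal_nonincreasing_is_cvgn.
move=> k vk_fin; exists (fine (ereal_inf (range v))).
rewrite fineK; first exact: ereal_nonincreasing_cvgn.
(* The infimum lies between 0 and [v k], hence is finite. *)
rewrite ge0_fin_numE.
  by apply: le_lt_trans vk_fin; apply: ereal_inf_lbound; exists k.
by apply: le_ereal_inf_tmp => _ [i _ <-].
Qed.
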